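(* Let $S\subseteq\mathbb{N}$ be a finite set with $|S|=k\geq 1$. Then $z_S\leq \frac{2}{\pi}\sqrt{k-1}$. Moreover, if $k\geq 2$, then $z_S\leq \frac14+\frac{2}{\pi}\left(\sqrt{k-1}-1\right)$, and this is at most $\frac{2}{\pi}\sqrt{k-1}$.
   Context: $\mathbb{N}=\{0,1,2,\dots\}$. For a finite nonempty set $S=\{e_1,\dots,e_k\}\subseteq\mathbb{N}$ (distinct elements), let $f_S(x)=\sum_{i=1}^k a_i x^{e_i}$, where $a_1,\dots,a_k$ are independent standard normal random variables. For an open interval $I\subseteq(0,\infty)$, $z_S^I$ denotes the expected number of zeros of $f_S$ in $I$, and $z_S:=z_S^{(0,1)}$. *)

(* Defs.v *)
From HB Require Import structures.
From mathcomp Require Import all_boot all_order all_algebra.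
From mathcomp Require Import all_classical all_reals all_analysis.
Set Implicit Arguments. Unset Strict Implicit. Unset Printing Implicit Defensive.
Import Order.TTheory GRing.Theory Num.Theory.
Local Open Scope classical_set_scope.
Local Open Scope ring_scope.

(* number of zeros of g in the open interval (a,b), as an extended real
   (+oo if infinitely many): the cardinality of the zero set, via esum of 1 *)
Definition nzeros_in {R : realType} (a b : R) (g : R -> R) : \bar R :=
  (\esum_(x in [set x : R | a < x < b /\ g x = 0]) (1%E : \bar R)).

(* f_S(x) = sum_i a_i x^{e_i}, S given by the duplicate-free list s = [e_1;...;e_k],
   coefficients given by the list c = [a_1;...;a_k] *)
Definition fS {R : realType} (s : seq nat) (c : seq R) (x : R) : R :=
  \sum_(i < size s) c`_i * x ^+ (nth 0%N s i).

(* Expectation of a nonnegative functional F of k i.i.d. standard normal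
   coefficients a_1,...,a_k: iterated Lebesgue integral against the
   standard normal density (equal to the product-measure integral by Tonelli). *)
Fixpoint gauss_expect {R : realType} (k : nat) (F : seq R -> \bar R) : \bar R :=
  match k with
  | 0%N => F [::]
  | k'.+1 => (\int[@lebesgue_measure R]_t
               ((normal_pdf 0 1 t)%:E * gauss_expect k' (fun c => F (t :: c))))%E
  end.

Definition zS_in {R : realType} (a b : R) (s : seq nat) : \bar R :=
  gauss_expect (size s) (fun c => nzeros_in a b (fS s c)).

Definition zS {R : realType} (s : seq nat) : \bar R := zS_in 0 1 s.

(* Main.v *)
(* The values f_S(x), f_S(y) form a Gaussian pair, and they have opposite signs
   with probability A_S(x, y) / pi, where A_S(x, y) is the angle between the
   vectors (x^e)_e and (y^e)_e, e in S.  Split off the largest exponent m: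
   S = S' + {m}, and let theta(x) be the elevation of (x^e)_{e in S} over the
   hyperplane spanned by S'.  A spherical triangle inequality gives
   A_S(x, y) <= (theta(y) - theta(x)) + A_{S'}(x, y) for x <= y, and theta is
   nondecreasing with theta(1) = atan(1 / sqrt(k - 1)).  Along any grid in (0, 1]
   these bounds telescope, so the expected number of sign changes is at most
   (1 / pi) sum_{1 <= j < k} atan(1 / sqrt j).  The first term is pi / 4 and the
   others are at most 1 / sqrt j <= 2 (sqrt j - sqrt (j - 1)).
   For almost every value of the last coefficient all zeros in (0, 1) are simple,
   hence each is eventually seen as a sign change on the grids of mesh
   1 / (n + 1), and Fatou's lemma concludes. *)
Require Import Defs.
From HB Require Import structures.
From mathcomp Require Import all_boot all_order all_algebra.
From mathcomp Require Import all_classical all_reals all_analysis.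
From mathcomp Require Import measurable_realfun ring lra.
Import Order.TTheory GRing.Theory Num.Theory.
Import numFieldNormedType.Exports.
Local Open Scope ring_scope.

Set Implicit Arguments.
Unset Strict Implicit.
Unset Printing Implicit Defensive.

(** * Gaussian expectation in one variable *)

Section GaussianExpectation.
Context {R : realType}.
Local Open Scope classical_set_scope.
Local Open Scope ereal_scope.
Notation mu := (@lebesgue_measure R).
Notation phi := (@normal_pdf R 0 1).

(* The integrals of [Defs] are also taken over functions not known to be
   measurable; as suprema over simple functions they are still monotone. *)
Lemma ge0_le_integral_nonmeas d (T : measurableType d)
    (m : {measure set T -> \bar R}) (f g : T -> \bar R) :
  (forall x, 0 <= f x) -> (forall x, f x <= g x) ->
  \int[m]_x f x <= \int[m]_x g x.
Proof.
move=> f0 fg; have g0 x : 0 <= g x by rewrite (le_trans (f0 x)).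
rewrite !ge0_integralTE//; apply: ereal_sup_le => _ [h hf <-].
by exists h => // x; rewrite (le_trans (hf x)).
Qed.

(** One layer of [gauss_expect]: at [k.+1] it is, by conversion, [gexp1] of the expectation over the
    remaining [k] coordinates. *)
Definition gexp1 (f : R -> \bar R) : \bar R := \int[mu]_t ((phi t)%:E * f t).

Lemma phi_ge0 t : 0 <= (phi t)%:E.
Proof. by rewrite lee_fin normal_pdf_ge0. Qed.

Lemma measurable_phi : measurable_fun setT (fun t => (phi t)%:E).
Proof. by apply/measurable_EFinP; exact: measurable_normal_pdf. Qed.

Lemma gexp1_ge0 f : (forall t, 0 <= f t) -> 0 <= gexp1 f.
Proof. by move=> f0; apply: integral_ge0 => t _; rewrite mule_ge0// phi_ge0. Qed.

Lemma eq_gexp1 f g : f =1 g -> gexp1 f = gexp1 g.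
Proof. by move=> /funext ->. Qed.

Lemma le_gexp1 f g : (forall t, 0 <= f t) -> (forall t, f t <= g t) ->
  gexp1 f <= gexp1 g.
Proof.
move=> f0 fg; apply: ge0_le_integral_nonmeas => t.
  by rewrite mule_ge0// phi_ge0.
by rewrite lee_wpmul2l// phi_ge0.
Qed.

Lemma measurable_gexp1 d (T : measurableType d) (f : T * R -> \bar R) :
  measurable_fun setT f -> (forall p, 0 <= f p) ->
  measurable_fun setT (fun t => gexp1 (fun y => f (t, y))).
Proof.
move=> mf f0.
rewrite /gexp1.
apply: (@measurable_fun_fubini_tonelli_F _ _ T _ R mu
  (fun p : T * R => (phi p.2)%:E * f p)) => [|p].
  apply: emeasurable_funM => //.
  exact: (measurableT_comp measurable_phi measurable_snd).
by rewrite mule_ge0// phi_ge0.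
Qed.

Lemma measurable_phiM f : measurable_fun setT f ->
  measurable_fun setT (fun t => (phi t)%:E * f t).
Proof. by move=> mf; apply: emeasurable_funM => //; exact: measurable_phi. Qed.

Lemma gexp1D f g : measurable_fun setT f -> measurable_fun setT g ->
  (forall t, 0 <= f t) -> (forall t, 0 <= g t) ->
  gexp1 (fun t => f t + g t) = gexp1 f + gexp1 g.
Proof.
move=> mf mg f0 g0; rewrite /gexp1 -ge0_integralD//; first last.
- exact: measurable_phiM.
- by move=> t _; rewrite mule_ge0// phi_ge0.
- exact: measurable_phiM.
- by move=> t _; rewrite mule_ge0// phi_ge0.
by apply: eq_integral => t _; rewrite ge0_muleDr.
Qed.

Lemma gexp1_cst (c : \bar R) : 0 <= c -> gexp1 (fun=> c) = c.
Proof.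
move=> c0; rewrite /gexp1 ge0_integralZr//.
- by rewrite integral_normal_pdf mul1e.
- exact: measurable_phi.
- by move=> t _; exact: phi_ge0.
Qed.

Lemma le_muleEFin_limn_einf (r : R) (u : (\bar R)^nat) : (0 <= r)%R ->
  (forall n, 0 <= u n) ->
  r%:E * limn_einf u <= limn_einf (fun n => r%:E * u n).
Proof.
move=> r0 u0; rewrite !limn_einf_lim.
rewrite (cvg_lim _ (@cvg_einfs_sup R u))//.
rewrite (cvg_lim _ (@cvg_einfs_sup R (fun n => r%:E * u n)))//.
rewrite -ereal_supZl//; last by apply/set0P; exists (einfs u 0%N), 0%N.
apply: ge_ereal_sup => _ [_ [n _ <-] <-].
apply: le_trans (ereal_sup_ubound _); last by exists n.
apply: le_ereal_inf_tmp => _ [k nk <-].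
rewrite lee_wpmul2l ?lee_fin//; apply: ereal_inf_lbound.
by exists k.
Qed.

Lemma limn_einf_ge0 (u : (\bar R)^nat) : (forall n, 0 <= u n) -> 0 <= limn_einf u.
Proof.
move=> u0; rewrite limn_einf_lim (cvg_lim _ (@cvg_einfs_sup R u))//.
apply: le_trans (ereal_sup_ubound _); last by exists 0%N.
by apply: le_ereal_inf_tmp => _ [n _ <-].
Qed.

(** Fatou's lemma is applied to the products [phi * f n]; at each point the factor [phi t] passes
    inside the lower limit by [le_muleEFin_limn_einf]. *)
Lemma gexp1_fatou (f : nat -> R -> \bar R) :
  (forall n, measurable_fun setT (f n)) -> (forall n t, 0 <= f n t) ->
  gexp1 (fun t => limn_einf (f ^~ t)) <= limn_einf (fun n => gexp1 (f n)).
Proof.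
move=> mf f0; apply: le_trans; last first.
  apply: fatou => // [n|n x _]; first exact: measurable_phiM.
  by rewrite mule_ge0// phi_ge0.
apply: ge0_le_integral_nonmeas => t.
  by rewrite mule_ge0// ?phi_ge0// limn_einf_ge0.
by apply: le_muleEFin_limn_einf; rewrite // normal_pdf_ge0.
Qed.

(** Raising [g] to [+oo] on the null set [A] gives a measurable [h] that dominates [f] everywhere
    and has the same integral as [g]. This covers an [f] not known to be measurable. *)
Lemma gexp1_le_ae (f g : R -> \bar R) (A : set R) :
  measurable_fun setT g -> (forall t, 0 <= f t) -> (forall t, 0 <= g t) ->
  countable A -> (forall t, ~ A t -> f t <= g t) ->
  gexp1 f <= gexp1 g.
Proof.
move=> mg f0 g0 cA fg.
have mA : measurable A by exact: countable_measurable.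
pose h t := if t \in A then +oo else g t.
have mh : measurable_fun setT h.
  apply: measurable_fun_ifT => //.
  apply: (measurable_fun_bool true); rewrite setTI.
  by rewrite [X in measurable X](_ : _ = A)//;
    by apply/seteqP; split => t /=; [exact: set_mem | exact: mem_set].
have h0 t : 0 <= h t by rewrite /h; case: ifP.
apply: (@le_trans _ _ (gexp1 h)).
  apply: le_gexp1 => // t; rewrite /h; case: ifPn => [_|]; first exact: leey.
  by rewrite notin_setE => /fg.
rewrite /gexp1 le_eqVlt; apply/orP; left; apply/eqP.
apply: ge0_ae_eq_integral => //.
- exact: measurable_phiM.
- exact: measurable_phiM.
- by move=> t _; rewrite mule_ge0// phi_ge0.
- by move=> t _; rewrite mule_ge0// phi_ge0.
exists A; split => //; first exact: countable_lebesgue_measure0.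
move=> t /=; apply: contra_notP => At _.
by rewrite /h memNset.
Qed.

(** Lebesgue measure is [|b|] times its pushforward under [t |-> a + b t]: the two agree on
    half-open intervals, and uniqueness does the rest. *)
Lemma integral_affine (a b : R) (f : R -> \bar R) : b != 0%R ->
  measurable_fun setT f -> (forall t, 0 <= f t) ->
  \int[mu]_t f t = `|b|%:E * \int[mu]_t f (a + b * t)%R.
Proof.
move=> b0 mf f0.
pose g : measurableTypeR R -> measurableTypeR R := fun t => (a + b * t)%R.
have mg : measurable_fun setT g.
  by apply: measurable_funD => //; exact: measurable_funM.
pose k : {nonneg R} := NngNum (normr_ge0 b).
have muE (A : set R) : measurable A ->
    mu A = mscale k (pushforward mu g) A.
  apply: lebesgue_measure_unique => //= _ [[x y] /= xy <-].
  rewrite /mscale/= /pushforward.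
  have [b_gt0|b_lt0|] := ltgtP 0%R b; last by move/eqP; rewrite eq_sym (negPf b0).
    rewrite (_ : g @^-1` _ = `]((x - a) / b)%R, ((y - a) / b)%R]%classic); last first.
      apply/seteqP; split => t /=; rewrite !in_itv/= /g;
        by rewrite ltr_pdivrMr// ler_pdivlMr// ltrBlDl lerBrDl (mulrC t).
    rewrite !lebesgue_measure_itv/= !lte_fin ltr_pM2r ?invr_gt0// ltrD2r.
    case: ifPn => _; last by rewrite mule0.
    rewrite -!EFinD -EFinM gtr0_norm//; congr EFin; field.
    by rewrite gt_eqF.
  (* A negative slope swaps the ends, so the preimage is closed on the left instead; its length is
     the same. *)
  rewrite (_ : g @^-1` _ = `[((y - a) / b)%R, ((x - a) / b)%R[%classic); last first.
    apply/seteqP; split => t /=; rewrite !in_itv/= /g;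
      by rewrite ltr_ndivlMr// ler_ndivrMr// ltrBlDl lerBrDl (mulrC t) andbC.
  rewrite !lebesgue_measure_itv/= !lte_fin ltr_nM2r ?invr_lt0// ltrD2r.
  case: ifPn => _; last by rewrite mule0.
  rewrite -!EFinD -EFinM ltr0_norm//; congr EFin; field.
  by rewrite lt_eqF.
have := @ge0_integral_pushforward _ _ _ _ R g mg mu setT f measurableT mf
  (fun t _ => f0 t).
rewrite preimage_setT => /= <-.
transitivity (k%:num%:E * \int[pushforward mu g]_t f t); last by [].
rewrite -ge0_integral_mscale//.
by apply: eq_measure_integral => A mA _; exact: muE.
Qed.

End GaussianExpectation.

(** * Rotation invariance and pairs of Gaussian values *)

Section GaussianRotation.
Context {R : realType}.
Local Open Scope classical_set_scope.
Local Open Scope ereal_scope.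
Notation mu := (@lebesgue_measure R).
Notation phi := (@normal_pdf R 0 1).

Lemma measurable_linear2 (a b : R) :
  measurable_fun setT (fun p : R * R => (a * p.1 + b * p.2)%R).
Proof. by apply: measurable_funD; exact: measurable_funM. Qed.

Lemma measurable_comp_linear2 (f : R * R -> \bar R) (a b c d : R) :
  measurable_fun setT f ->
  measurable_fun setT
    (fun p : R * R => f (a * p.1 + b * p.2, c * p.1 + d * p.2)%R).
Proof.
move=> mf; apply: (measurableT_comp mf).
by apply: measurable_fun_pair; exact: measurable_linear2.
Qed.

(** For [s != 0] the rotation splits into affine substitutions in one variable each, [u = c x - s y]
    at fixed [x] and [y = (x - c u) / s] at fixed [u], with Tonelli in between; the Jacobians [|s|]
    and [1 / |s|] cancel. For [s = 0] both variables are multiplied by [c], which is 1 or -1. *)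
Lemma integral_rotation (c s : R) (f : R * R -> \bar R) :
  (c ^+ 2 + s ^+ 2 = 1)%R -> measurable_fun setT f -> (forall p, 0 <= f p) ->
  \int[mu]_x \int[mu]_y f (x, y) =
  \int[mu]_x \int[mu]_y f (c * x - s * y, s * x + c * y)%R.
Proof.
move=> cs mf f0.
have mf1 x : measurable_fun setT (fun y => f (x, y)).
  exact: measurableT_comp mf (measurable_pair1 x).
have mf2 y : measurable_fun setT (fun x => f (x, y)).
  exact: measurableT_comp mf (measurable_pair2 y).
have mF (g : R * R -> \bar R) : measurable_fun setT g -> (forall p, 0 <= g p) ->
    measurable_fun setT (fun x => \int[mu]_y g (x, y)).
  by move=> mg g0; exact: (@measurable_fun_fubini_tonelli_F _ _ R _ R mu g).
have [s0|s0] := eqVneq s 0%R.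
  have c2 : (c ^+ 2 = 1)%R by rewrite -cs s0 expr0n addr0.
  have c0 : c != 0%R by rewrite -sqrf_eq0 c2 oner_eq0.
  have c1 : (`|c| = 1)%R.
    by apply/eqP; rewrite -(@eqrXn2 _ 2)// real_normK ?num_real// c2 expr1n.
  rewrite s0 (integral_affine 0 c0 (mF _ mf f0)); last first.
    by move=> x; exact: integral_ge0.
  rewrite c1 mul1e; apply: eq_integral => x _.
  rewrite (integral_affine 0 c0 (mf1 _))// c1 mul1e.
  by apply: eq_integral => y _; rewrite add0r add0r mul0r subr0 mul0r add0r.
have Ns0 : (- s != 0)%R by rewrite oppr_eq0.
have Vs0 : (s^-1 != 0)%R by rewrite invr_eq0.
pose g (p : R * R) := f (c * p.1 + (- s) * p.2, s * p.1 + c * p.2)%R.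
have mg : measurable_fun setT g by exact: measurable_comp_linear2.
(* The rotated integrand, with [u = c x - s y] in place of [y]. *)
pose h (p : R * R) := f (p.2, (s^-1 * p.1 + (- (c / s)) * p.2)%R).
have mh : measurable_fun setT h.
  apply: (measurableT_comp mf); apply: measurable_fun_pair => //.
  exact: measurable_linear2.
transitivity (`|s^-1|%:E * \int[mu]_x \int[mu]_u h (x, u)); last first.
  transitivity (\int[mu]_x (`|s^-1|%:E * \int[mu]_u h (x, u))).
    rewrite ge0_integralZl ?lee_fin//; first exact: (mF h mh (fun p => f0 _)).
    by move=> x _; apply: integral_ge0 => u _; exact: f0.
  apply: eq_integral => x _.
  have mhx : measurable_fun setT (fun u => h (x, u)).
    exact: measurableT_comp mh (measurable_pair1 x).
  rewrite (integral_affine (c * x)%R Ns0 mhx); last by move=> u; exact: f0.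
  rewrite muleA -EFinM normrN -normrM mulVf// normr1 mul1e.
  apply: eq_integral => y _; rewrite /h/= mulNr; congr (f (_, _)).
  have -> : (s^-1 * x = s^-1 * ((c ^+ 2 + s ^+ 2) * x))%R by rewrite cs mul1r.
  by field.
have mG : measurable_fun setT (fun u => \int[mu]_x h (x, u)).
  have := @measurable_fun_fubini_tonelli_G _ _ (measurableTypeR R)
    (measurableTypeR R) R mu h mh (fun p => f0 _).
  exact.
have <- : \int[mu]_u \int[mu]_x h (x, u) = \int[mu]_x \int[mu]_u h (x, u).
  apply/esym.
  exact: (@fubini_tonelli _ _ (measurableTypeR R) (measurableTypeR R) R
    mu mu h mh (fun p => f0 _)).
rewrite -ge0_integralZl ?lee_fin//; last first.
  by move=> u _; apply: integral_ge0 => x _; exact: f0.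
apply: eq_integral => u _; rewrite (integral_affine (- (c / s) * u)%R Vs0 (mf1 u))//.
congr (_ * _); apply: eq_integral => x _; rewrite /h/=.
by congr (f (_, _)); rewrite addrC.
Qed.

Lemma gexp2E (f : R * R -> \bar R) :
  measurable_fun setT f -> (forall p, 0 <= f p) ->
  gexp1 (fun x => gexp1 (fun y => f (x, y))) =
  \int[mu]_x \int[mu]_y ((phi x * phi y)%:E * f (x, y)).
Proof.
move=> mf f0; apply: eq_integral => x _.
have mfx : measurable_fun setT (fun y => f (x, y)).
  exact: measurableT_comp mf (measurable_pair1 x).
rewrite /gexp1 -ge0_integralZl ?phi_ge0//.
- by apply: eq_integral => y _; rewrite muleA EFinM.
- exact: measurable_phiM.
- by move=> y _; rewrite mule_ge0// phi_ge0.
Qed.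

Lemma phiE (x : R) : phi x = ((Num.sqrt (pi *+ 2))^-1 * expR (- x ^+ 2 / 2))%R.
Proof.
rewrite normal_pdfE ?oner_eq0// /normal_peak /normal_fun subr0 expr1n mul1r.
by [].
Qed.

Lemma phiM (x y : R) :
  (phi x * phi y = (pi *+ 2)^-1 * expR (- (x ^+ 2 + y ^+ 2) / 2))%R.
Proof.
have pi2 : (0 <= pi *+ 2 :> R)%R by rewrite mulrn_wge0// pi_ge0.
by rewrite !phiE mulrACA -invfM -expr2 sqr_sqrtr// -expRD -mulrDl -opprD.
Qed.

(** The joint density depends only on [x ^+ 2 + y ^+ 2], which a rotation preserves. *)
Lemma gexp2_rotation (c s : R) (f : R * R -> \bar R) :
  (c ^+ 2 + s ^+ 2 = 1)%R -> measurable_fun setT f -> (forall p, 0 <= f p) ->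
  gexp1 (fun x => gexp1 (fun y => f (x, y))) =
  gexp1 (fun x => gexp1 (fun y => f (c * x - s * y, s * x + c * y)%R)).
Proof.
move=> cs mf f0.
have mg : measurable_fun setT
    (fun p : R * R => f (c * p.1 - s * p.2, s * p.1 + c * p.2)%R).
  under eq_fun do rewrite -mulNr.
  exact: measurable_comp_linear2.
pose G (p : R * R) := (phi p.1 * phi p.2)%:E * f p.
have mG : measurable_fun setT G.
  apply: emeasurable_funM => //; apply/measurable_EFinP.
  by apply: measurable_funM; apply: measurableT_comp => //;
    exact: measurable_normal_pdf.
have G0 p : 0 <= G p by rewrite mule_ge0// EFinM mule_ge0// phi_ge0.
apply: (etrans (gexp2E mf f0)).
apply: (etrans _ (esym (gexp2E mg (fun p => f0 _)))).
apply: (etrans (integral_rotation cs mG G0)).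
apply: eq_integral => x _; apply: eq_integral => y _; rewrite /G/=.
have E : ((c * x - s * y) ^+ 2 + (s * x + c * y) ^+ 2 = x ^+ 2 + y ^+ 2)%R.
  transitivity ((c ^+ 2 + s ^+ 2) * (x ^+ 2 + y ^+ 2))%R; first by ring.
  by rewrite cs mul1r.
have -> : (phi (c * x - s * y) * phi (s * x + c * y) = phi x * phi y)%R.
  by apply: (etrans (phiM _ _)); rewrite E; apply/esym; exact: phiM.
by [].
Qed.

Lemma polar_coordinates (a b : R) :
  exists r c s : R, [/\ c ^+ 2 + s ^+ 2 = 1, a = r * c & b = r * s]%R.
Proof.
pose r := Num.sqrt (a ^+ 2 + b ^+ 2).
have ab0 : (0 <= a ^+ 2 + b ^+ 2)%R by rewrite addr_ge0 ?sqr_ge0.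
have [r0|r0] := eqVneq r 0%R.
  move/eqP: r0; rewrite sqrtr_eq0 => ab.
  have /eqP : (a ^+ 2 + b ^+ 2 = 0)%R by apply/eqP; rewrite eq_le ab ab0.
  rewrite paddr_eq0 ?sqr_ge0// !sqrf_eq0 => /andP[/eqP-> /eqP->].
  by exists 0%R, 1%R, 0%R; rewrite expr1n expr0n addr0 mul0r mul0r.
exists r, (a / r)%R, (b / r)%R; split.
- by rewrite !expr_div_n -mulrDl sqr_sqrtr// divff// -[X in X != _]sqr_sqrtr//
    expf_neq0.
- by rewrite mulrC divfK.
- by rewrite mulrC divfK.
Qed.

(** A rotation of [(t, x)] makes the first form a multiple of [t] alone; a rotation of the other two
    variables then makes the rest of the second form a multiple of one of them, and the third
    integrates out. The three equations say that the Gram matrix of the two forms is preserved. *)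
Lemma gexp3_merge (v w al be ga : R) : exists al' be' ga' : R,
  [/\ (al' ^+ 2 = v ^+ 2 + al ^+ 2)%R, (al' * be' = v * w + al * be)%R,
      (be' ^+ 2 + ga' ^+ 2 = w ^+ 2 + (be ^+ 2 + ga ^+ 2))%R &
  forall f : R * R -> \bar R,
    measurable_fun setT f -> (forall p, 0 <= f p) ->
    gexp1 (fun t => gexp1 (fun x => gexp1 (fun y =>
      f (v * t + al * x, w * t + (be * x + ga * y))%R))) =
    gexp1 (fun x => gexp1 (fun y => f (al' * x, be' * x + ga' * y)%R))].
Proof.
have [r [c [s [cs -> ->]]]] := polar_coordinates v al.
(* These are the coefficients that the second form has outside [t] after the first rotation; their
   direction [(c', s')] gives the second one. *)
have [r' [c' [s' [cs' dE gaE]]]] := polar_coordinates (be * c - w * s)%R ga.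
exists r, (w * c + be * s)%R, r'; split.
- by rewrite !exprMn -mulrDr cs mulr1.
- by ring.
- transitivity ((w * c + be * s) ^+ 2 + r' ^+ 2 * (c' ^+ 2 + s' ^+ 2))%R.
    by rewrite cs' mulr1.
  rewrite mulrDr -!exprMn -dE -gaE.
  transitivity ((w ^+ 2 + be ^+ 2) * (c ^+ 2 + s ^+ 2) + ga ^+ 2)%R; first by ring.
  by rewrite cs mulr1 addrA.
move=> f mf f0.
have mf3 (a1 a2 a3 b1 b2 b3 : R) : measurable_fun setT (fun p : (R * R) * R =>
    f (a1 * p.1.1 + (a2 * p.1.2 + a3 * p.2),
       b1 * p.1.1 + (b2 * p.1.2 + b3 * p.2))%R).
  apply: (measurableT_comp mf).
  apply: measurable_fun_pair; repeat apply: measurable_funD;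
    by apply: measurable_funM => //; exact: measurableT_comp.
pose H (p : R * R) := gexp1 (fun y =>
  f (r * c * p.1 + r * s * p.2, w * p.1 + (be * p.2 + ga * y))%R).
have mH : measurable_fun setT H.
  apply: (@measurable_gexp1 _ _ _ (fun p : (R * R) * R =>
    f (r * c * p.1.1 + r * s * p.1.2, w * p.1.1 + (be * p.1.2 + ga * p.2))%R)) => //.
  have := mf3 (r * c)%R (r * s)%R 0%R w be ga.
  by under [X in measurable_fun _ X -> _]eq_fun do rewrite mul0r addr0.
have H0 p : 0 <= H p by exact: gexp1_ge0.
apply: (etrans (gexp2_rotation cs mH H0)).
apply: eq_gexp1 => t.
pose G (p : R * R) := f (r * t, (w * c + be * s) * t +
  ((be * c - w * s) * p.1 + ga * p.2))%R.
have mG : measurable_fun setT G.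
  apply: (measurableT_comp mf); apply: measurable_fun_pair => //.
  by apply: measurable_funD => //; exact: measurable_linear2.
transitivity (gexp1 (fun x => gexp1 (fun y => G (x, y)))).
  apply: eq_gexp1 => x; apply: eq_gexp1 => y; rewrite /G/=.
  congr (f (_, _)); last by ring.
  by transitivity (r * t * (c ^+ 2 + s ^+ 2))%R; [ring|rewrite cs mulr1].
apply: (etrans (gexp2_rotation cs' mG (fun p => f0 _))).
apply: eq_gexp1 => x.
(* The last variable has dropped out, and its Gaussian integral is 1. *)
rewrite /G/= dE gaE -[RHS]gexp1_cst//; apply: eq_gexp1 => y.
congr (f (_, _ + _)%R).
by transitivity (r' * x * (c' ^+ 2 + s' ^+ 2))%R; [ring|rewrite cs' mulr1].
Qed.

(** * Reduction of the coefficient list to a Gaussian pair *)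

Lemma fS_cons e s (t : R) c x :
  fS (e :: s) (t :: c) x = (x ^+ e * t + fS s c x)%R.
Proof. by rewrite /fS big_ord_recl/= mulrC. Qed.

(* The vectors (al, 0) and (be, ga) have the same Gram matrix as the vectors
   (x ^+ e)_e and (y ^+ e)_e. *)
Lemma gauss_expect_pair (s : seq nat) (x y : R) : exists al be ga : R,
  [/\ (al ^+ 2 = \sum_(e <- s) (x * x) ^+ e)%R,
      (al * be = \sum_(e <- s) (x * y) ^+ e)%R,
      (be ^+ 2 + ga ^+ 2 = \sum_(e <- s) (y * y) ^+ e)%R &
  forall f : R * R -> \bar R,
    measurable_fun setT f -> (forall p, 0 <= f p) ->
    gauss_expect (size s) (fun c => f (fS s c x, fS s c y)) =
    gexp1 (fun u => gexp1 (fun v => f (al * u, be * u + ga * v)%R))].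
Proof.
elim: s => [|e s [al [be [ga [alE albeE bega IH]]]]].
  exists 0%R, 0%R, 0%R; rewrite !big_nil expr0n addr0 mul0r; split => //.
  move=> f mf f0; rewrite /= /fS !big_ord0.
  under eq_gexp1 do (under eq_gexp1 do rewrite !mul0r addr0; rewrite gexp1_cst//).
  by rewrite gexp1_cst.
(* The first coefficient [t] adds [x ^+ e * t] and [y ^+ e * t] to the pair that represents the
   others; the merge brings three variables back to two, and the Gram matrices add up. *)
have [al' [be' [ga' [alE' albeE' bega' E]]]] :=
  gexp3_merge (x ^+ e) (y ^+ e) al be ga.
exists al', be', ga'; rewrite !big_cons !exprMn; split => [|||f mf f0].
- by rewrite alE' alE expr2.
- by rewrite albeE' albeE.
- by rewrite bega' bega expr2.
rewrite -E// /=; apply: eq_gexp1 => t.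
rewrite -(IH (fun p => f (x ^+ e * t + p.1, y ^+ e * t + p.2)%R))//.
  by congr gauss_expect; apply/funext => c; rewrite !fS_cons.
apply: (measurableT_comp mf).
by apply: measurable_fun_pair; apply: measurable_funD.
Qed.

End GaussianRotation.

(** * Sign changes of a Gaussian pair *)

Section GaussianAngle.
Context {R : realType}.
Local Open Scope classical_set_scope.
Local Open Scope ring_scope.
Notation mu := (@lebesgue_measure R).
Notation phi := (@normal_pdf R 0 1).

Lemma integral_normM_gauss (q : R) : 0 < q ->
  (\int[mu]_x (`|x| * expR (- (q / 2 * x ^+ 2)))%:E = (2 / q)%:E)%E.
Proof.
move=> q0; have q20 : 0 < q / 2 by rewrite divr_gt0.
have cexp : continuous (fun x : R => expR (- (q / 2 * x ^+ 2))).
  move=> x; apply: (@continuous_comp _ _ _ (fun x : R => - (q / 2 * x ^+ 2)) expR).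
    by apply: cvgN; apply: cvgM; [exact: cvg_cst|exact: exprn_continuous].
  exact: continuous_expR.
rewrite ge0_symfun_integralT; first last.
- by move=> x; rewrite /= normrN sqrrN.
- by move=> x; apply: cvgM; [exact: norm_continuous|exact: cexp].
- by move=> x; rewrite mulr_ge0// expR_ge0.
rewrite (_ : [set x : R | 0 <= x] = `[0, +oo[%classic); last first.
  by apply/seteqP; split => x /=; rewrite in_itv/= andbT.
pose F x : R := - q^-1 * expR (- (q / 2 * x ^+ 2)).
have dF (x : R) : is_derive x (1 : R) F (x * expR (- (q / 2 * x ^+ 2))).
  have d1 : is_derive x (1 : R) (fun x : R => - (q / 2 * x ^+ 2)) (- (q * x)).
    have d0 : is_derive x (1 : R) (fun x : R => x ^+ 2) (2 * x).
      by apply: is_derive_eq; rewrite [x%:A]mulr1 mulr_natl mulr2n.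
    apply: (is_derive_eq (is_deriveN (is_deriveZ (q / 2) d0))).
    by rewrite [_ *: _]mulrA divfK.
  have d2 := is_deriveZ (- q^-1) (is_derive1_comp (is_derive_expR _) d1).
  apply: (is_derive_eq d2).
  rewrite [_ *: _]mulrC; field.
  by rewrite gt_eqF.
transitivity (2%:E *
    \int[mu]_(x in `[0%R, +oo[) (x * expR (- (q / 2 * x ^+ 2)))%:E)%E.
  congr (_ * _)%E; apply: eq_integral => x.
  by rewrite inE/= in_itv/= andbT => x0; rewrite ger0_norm.
rewrite (@ge0_continuous_FTC2y _ _ F 0 0).
- by rewrite /F expr0n/= mulr0 oppr0 expR0 mulr1 -EFinB sub0r opprK -EFinM.
- by move=> x x0; rewrite mulr_ge0// expR_ge0.
- apply: continuous_subspaceT => x.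
  by apply: cvgM; [exact: cvg_id|exact: cexp].
- rewrite -[X in _ --> X](mulr0 (- q^-1)); apply: cvgM; first exact: cvg_cst.
  apply: (cvg_comp (fun x : R => q / 2 * x ^+ 2) (fun x => expR (- x))).
    apply: gt0_cvgMry => //; exact: cvgr_expr2.
  exact: cvgr_expR.
- by move=> x _; case: (dF x).
- apply: cvg_at_right_filter; apply: cvgM; first exact: cvg_cst.
  exact: cexp.
- by move=> x _; rewrite derive1E; exact: derive_val.
Qed.

Lemma integral_oneDsqr_tail (tau : R) :
  (\int[mu]_(x in `[tau, +oo[) (oneDsqr x)^-1%:E = (pi / 2 - atan tau)%:E)%E.
Proof.
rewrite (ge0_continuous_FTC2y _ _ (@cvgy_atan R))/=.
- by [].
- by move=> x _; rewrite invr_ge0 (le_trans _ (oneDsqr_ge1 x)).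
- apply/continuous_within_itvcyP; split.
    by move=> x x0; apply: continuous_oneDsqrV.
  by apply: cvg_at_right_filter; exact: continuous_oneDsqrV.
- by move=> x x0; apply: ex_derive.
- by apply: cvg_at_right_filter; exact: continuous_atan.
- by move=> x _; rewrite derive1E; exact: derive_val.
Qed.

Lemma sin_atan (x : R) : sin (atan x) = x * cos (atan x).
Proof.
have c0 : cos (atan x) != 0.
  by rewrite gt_eqF// cos_gt0_pihalf// atan_gtNpi2 atan_ltpi2.
by rewrite -[X in X * _](atanK x) /tan divfK.
Qed.

(** With [tau = b / |g|] the quotient is [tau / sqrt (1 + tau^2)], the sine of [atan tau]. *)
Lemma acos_div_sqrt (b g : R) : 0 < b -> g != 0 ->
  acos (b / Num.sqrt (b ^+ 2 + g ^+ 2)) = pi / 2 - atan (b / `|g|).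
Proof.
move=> b0 g0; set tau := b / `|g|.
have ng0 : 0 < `|g| by rewrite normr_gt0.
have tau0 : 0 < tau by rewrite divr_gt0.
have -> : b / Num.sqrt (b ^+ 2 + g ^+ 2) = sin (atan tau).
  rewrite sin_atan cos_atan.
  have -> : b ^+ 2 + g ^+ 2 = `|g| ^+ 2 * (1 + tau ^+ 2).
    by rewrite /tau real_normK ?num_real// expr_div_n real_normK ?num_real//; field.
  by rewrite sqrtrM ?sqr_ge0// sqrtr_sqr normr_id invfM mulrA.
rewrite -cosBpihalf -cosN opprB cosK// in_itv/=.
have h := atan_ltpi2 tau; have h' : 0 < atan tau by rewrite -(@atan0 R) lt_atan.
by rewrite subr_ge0 (ltW h)/= lerBlDr (le_trans (_ : _ <= pi))//;
  [have := pi_gt0 R; lra | rewrite lerDl ltW].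
Qed.

Lemma measurable_le0 d (T : measurableType d) (h : T -> R) :
  measurable_fun setT h -> measurable_fun setT (fun t => (h t <= 0)%R%:R : R).
Proof.
move=> mh.
have -> : (fun t => (h t <= 0)%R%:R : R) = \1_(h @^-1` `]-oo, 0%R]).
  apply/funext => t; rewrite indicE; congr (nat_of_bool _)%:R.
  by apply/idP/idP => [h0|]; rewrite ?inE/= ?in_itv//= mem_setE/= in_itv.
by apply: measurable_indic; rewrite -[X in measurable X]setTI; exact: mh.
Qed.

(** For [b = al * be] and [g = al * ga] this is, up to the factor [1 / pi], the Cauchy density of
    the ratio [w = v / u], restricted to the ratios at which the pair changes sign. *)
Let halfline (b g w : R) : \bar R := ((b + g * w <= 0)%R%:R / oneDsqr w)%:E.

Let measurable_halfline b g : measurable_fun setT (halfline b g).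
Proof.
apply/measurable_EFinP; apply: measurable_funM.
  by apply: measurable_le0; apply: measurable_funD => //; exact: measurable_funM.
by apply: continuous_measurable_fun; exact: continuous_oneDsqrV.
Qed.

Let halfline_ge0 b g w : (0 <= halfline b g w)%E.
Proof. by rewrite lee_fin divr_ge0// (le_trans _ (oneDsqr_ge1 w)). Qed.

Lemma integral_oneDsqr_halfline (b g : R) : 0 < b -> g != 0 ->
  (\int[mu]_w ((b + g * w <= 0)%R%:R / oneDsqr w)%:E =
   (pi / 2 - atan (b / `|g|))%:E)%E.
Proof.
move=> b0 g0; rewrite -integral_oneDsqr_tail [in RHS]integral_mkcond.
have [gp|gn|/eqP] := ltgtP 0 g; last by rewrite eq_sym (negPf g0).
  have N10 : (-1 : R) != 0 by rewrite oppr_eq0 oner_eq0.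
  (* The reflection of [w] turns a lower half-line into an upper one. *)
  rewrite (integral_affine 0 N10 (measurable_halfline b g) (halfline_ge0 b g)) normrN1 mul1e.
  apply: eq_integral => w _; rewrite add0r mulN1r /halfline mulrN subr_le0 patchE.
  rewrite /oneDsqr sqrrN (gtr0_norm gp).
  have -> : (b <= g * w) = (b / g <= w) by rewrite ler_pdivrMr// mulrC.
  case: ifPn; rewrite ?inE ?notin_setE/= in_itv/= andbT;
    first by move=> ->; rewrite mul1r.
  by move/negP/negPf => ->; rewrite mul0r.
apply: eq_integral => w _; rewrite patchE (ltr0_norm gn).
have -> : (b + g * w <= 0) = (b / - g <= w).
  by rewrite ler_pdivrMr ?oppr_gt0// mulrN mulrC -lerBrDr sub0r.
case: ifPn; rewrite ?inE ?notin_setE/= in_itv/= andbT;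
    first by move=> ->; rewrite mul1r.
by move/negP/negPf => ->; rewrite mul0r.
Qed.

(** Substituting [v = u w] turns the product into [u ^+ 2 * (b + g * w)], whose sign does not depend
    on [u != 0]. Integrating out [u] leaves the Cauchy law of the ratio [w], evaluated on a
    half-line. *)
Lemma gexp2_le0_le (al be ga : R) : 0 < al * be ->
  (gexp1 (fun u : R => gexp1 (fun v : R =>
     ((al * u) * (be * u + ga * v) <= 0)%R%:R%:E)) <=
   (acos (al * be / Num.sqrt (al ^+ 2 * (be ^+ 2 + ga ^+ 2))) / pi)%:E)%E.
Proof.
move=> albe0; have al0 : al != 0 by apply: contraTneq albe0 => ->; rewrite mul0r ltxx.
set b := al * be in albe0 *; pose g := al * ga.
have -> : al ^+ 2 * (be ^+ 2 + ga ^+ 2) = b ^+ 2 + g ^+ 2.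
  by rewrite /b /g; ring.
pose chi w : R := (b + g * w <= 0)%R%:R.
have mchi : measurable_fun setT chi.
  by apply: measurable_le0; apply: measurable_funD => //; exact: measurable_funM.
pose K (p : R * R) : \bar R := (phi p.1 * (chi p.2 * (`|p.1| * phi (p.1 * p.2))))%:E.
have mphi := @measurable_normal_pdf R 0 1.
have mK : measurable_fun setT K.
  apply/measurable_EFinP; apply: measurable_funM; first exact: measurableT_comp.
  apply: measurable_funM; first exact: measurableT_comp.
  apply: measurable_funM; first by apply: measurableT_comp.
  by apply: measurableT_comp => //; exact: measurable_funM.
have K0 p : (0 <= K p)%E.
  by rewrite lee_fin mulr_ge0 ?normal_pdf_ge0// mulr_ge0// mulr_ge0// normal_pdf_ge0.
pose L (p : R * R) : \bar R := (chi p.2 * (`|p.1| * phi (p.1 * p.2)))%:E.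
have mL : measurable_fun setT L.
  apply/measurable_EFinP.
  apply: measurable_funM; first exact: measurableT_comp.
  apply: measurable_funM; first by apply: measurableT_comp.
  by apply: measurableT_comp => //; exact: measurable_funM.
have L0 p : (0 <= L p)%E.
  by rewrite lee_fin mulr_ge0// mulr_ge0// normal_pdf_ge0.
have mL1 u : measurable_fun setT (fun w => L (u, w)).
  exact: measurableT_comp mL (measurable_pair1 u).
apply: (@le_trans _ _ (gexp1 (fun u => \int[mu]_w L (u, w))%E)).
  (* The substitution needs [u != 0]; the origin is a null set. *)
  apply: (@gexp1_le_ae _ _ _ [set 0]).
  - exact: (@measurable_fun_fubini_tonelli_F _ _ R (measurableTypeR R) R mu L mL L0).
  - by move=> u; apply: gexp1_ge0 => v; rewrite lee_fin.
  - by move=> u; apply: integral_ge0 => v _; exact: L0.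
  - exact: countable1.
  move=> u /eqP u0; rewrite /gexp1.
  have mu0 : measurable_fun setT (fun v : R =>
      ((phi v)%:E * ((al * u * (be * u + ga * v) <= 0)%R%:R)%:E)%E).
    apply: measurable_phiM; apply/measurable_EFinP; apply: measurable_le0.
    apply: measurable_funM => //; by apply: measurable_funD => //; exact: measurable_funM.
  rewrite (integral_affine 0 u0 mu0); last first.
    by move=> v; rewrite -EFinM lee_fin mulr_ge0// normal_pdf_ge0.
  rewrite -ge0_integralZl//; first last.
  - by move=> v _; rewrite -EFinM lee_fin mulr_ge0// normal_pdf_ge0.
  - have mu1 : measurable_fun setT (fun v : R => 0 + u * v).
      by apply: measurable_funD => //; exact: measurable_funM.
    exact: (measurableT_comp mu0 mu1).
  apply: ge0_le_integral_nonmeas => v.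
    by rewrite -!EFinM lee_fin mulr_ge0// mulr_ge0// normal_pdf_ge0.
  rewrite add0r /L/= -!EFinM lee_fin le_eqVlt; apply/orP; left; apply/eqP.
  rewrite mulrA [RHS]mulrC; congr (_ * _%:R).
  have -> : al * u * (be * u + ga * (u * v)) = u ^+ 2 * (b + g * v).
    by rewrite /b /g; ring.
  by rewrite pmulr_rle0// exprn_even_gt0.
have -> : gexp1 (fun u => \int[mu]_w L (u, w))%E =
    (\int[mu]_u \int[mu]_w K (u, w))%E.
  apply: eq_integral => u _; rewrite -ge0_integralZl ?phi_ge0//.
  exact: mL1.
have -> : (\int[mu]_u \int[mu]_w K (u, w) = \int[mu]_w \int[mu]_u K (u, w))%E.
  exact: (@fubini_tonelli _ _ (measurableTypeR R) (measurableTypeR R) R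
    mu mu K mK K0).
(* The integral over [u] produces the density [1 / (pi (1 + w^2))]. *)
have inner w : (\int[mu]_u K (u, w) = pi^-1%:E * (chi w / oneDsqr w)%:E)%E.
  have q0 : 0 < oneDsqr w by rewrite (lt_le_trans ltr01)// oneDsqr_ge1.
  transitivity (((pi *+ 2)^-1 * chi w)%:E *
      \int[mu]_u (`|u| * expR (- (oneDsqr w / 2 * u ^+ 2)))%:E)%E.
    rewrite -ge0_integralZl//; first last.
    - by rewrite lee_fin mulr_ge0// invr_ge0 mulrn_wge0// pi_ge0.
    - apply/measurable_EFinP; apply: measurable_funM => //.
      apply: measurableT_comp => //; apply: measurableT_comp => //.
      by apply: measurable_funM => //; exact: measurable_funX.
    apply: eq_integral => u _; rewrite -EFinM; congr EFin; rewrite /K/=.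
    transitivity (chi w * `|u| * (phi u * phi (u * w))); first by ring.
    rewrite phiM; have -> : - (u ^+ 2 + (u * w) ^+ 2) / 2 = - (oneDsqr w / 2 * u ^+ 2).
      by rewrite /oneDsqr; field.
    by ring.
  rewrite integral_normM_gauss// -!EFinM; congr EFin.
  have : pi != 0 :> R by rewrite gt_eqF// pi_gt0.
  by move: (pi : R) => p p0; field; rewrite p0 gt_eqF.
under eq_integral do rewrite inner.
rewrite ge0_integralZl//; first last.
- by rewrite lee_fin invr_ge0 pi_ge0.
- by move=> w _; exact: halfline_ge0.
- exact: measurable_halfline.
(* For [g = 0] the condition [b + g * w <= 0] never holds, as [b > 0]; the left side is 0 and [acos]
   is nonnegative. *)
have [g0|g0] := eqVneq g 0.
  rewrite [X in (_ * X)%E]integral0_eq ?mule0.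
    rewrite lee_fin divr_ge0 ?pi_ge0// acos_ge0//.
    rewrite g0 expr0n addr0 sqrtr_sqr gtr0_norm// divff ?gt_eqF// lexx andbT.
    by rewrite lerNl (le_trans _ ler01)// oppr_le0.
  by move=> w _; rewrite /chi g0 mul0r addr0 leNgt albe0 mul0r.
by rewrite integral_oneDsqr_halfline// -EFinM lee_fin acos_div_sqrt// mulrC.
Qed.

End GaussianAngle.

(** * Angles between points of the moment curve *)

Section AngleTelescoping.
Context {R : realType}.
Local Open Scope ring_scope.
Implicit Types (x y : R) (s : seq nat).

Lemma acos_le_of_cos_le (u z : R) : -1 <= u <= 1 -> 0 <= z <= pi -> cos z <= u ->
  acos u <= z.
Proof.
move=> u1 z0 zu; rewrite leNgt; apply/negP => zlt.
have z_in : z \in `[0, pi] by rewrite in_itv.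
have u_in : acos u \in `[0, pi] by rewrite in_itv/= acos_ge0// acos_lepi.
have : cos (acos u) < cos z by rewrite ltr_cos.
by rewrite acosK// ltNge zu.
Qed.

Lemma cos_sin_atan_div (a p : R) : 0 < p ->
  cos (atan (a / p)) = p / Num.sqrt (p ^+ 2 + a ^+ 2) /\
  sin (atan (a / p)) = a / Num.sqrt (p ^+ 2 + a ^+ 2).
Proof.
move=> p0; have q0 : p != 0 by rewrite gt_eqF.
have cE : cos (atan (a / p)) = p / Num.sqrt (p ^+ 2 + a ^+ 2).
  rewrite cos_atan.
  have -> : p ^+ 2 + a ^+ 2 = p ^+ 2 * (1 + (a / p) ^+ 2) by field.
  rewrite sqrtrM ?sqr_ge0// sqrtr_sqr gtr0_norm// invfM mulrA divff//.
  by rewrite mul1r.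
by split=> //; rewrite sin_atan cE mulrA divfK.
Qed.

(* Spherical triangle inequality: the vectors (p v, a) and (q w, b), with v and w
   unit vectors at angle acos (C / (p q)), are compared with (q v, b). *)
Lemma acos_suspension_le (p q C a b : R) :
  0 < p -> 0 < q -> 0 < C -> C <= p * q -> 0 <= a -> a / p <= b / q ->
  acos ((C + a * b) / (Num.sqrt (p ^+ 2 + a ^+ 2) * Num.sqrt (q ^+ 2 + b ^+ 2)))
    <= (atan (b / q) - atan (a / p)) + acos (C / (p * q)).
Proof.
move=> p0 q0 C0 Cpq a0 apbq.
have [cth sth] := cos_sin_atan_div a p0.
have [cet set] := cos_sin_atan_div b q0.
set th := atan (a / p) in cth sth *; set et := atan (b / q) in cet set *.
set A := acos (C / (p * q)).
have pq0 : 0 < p * q by rewrite mulr_gt0.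
have b0 : 0 <= b.
  have : 0 <= b / q by rewrite (le_trans _ apbq)// divr_ge0// ltW.
  by rewrite pmulr_lge0// invr_gt0.
have rho1 : 0 <= C / (p * q) <= 1.
  by rewrite (divr_ge0 (ltW C0) (ltW pq0))/= ler_pdivrMr// mul1r.
have rho : -1 <= C / (p * q) <= 1.
  by case/andP: rho1 => h ->; rewrite andbT (le_trans _ h)// lerN10.
have A0 : 0 <= A by rewrite acos_ge0.
(* Positivity of [C] keeps [A] at most [pi / 2], so that the right-hand side stays in [[0, pi]],
   where [acos_le_of_cos_le] applies. *)
have Api2 : A <= pi / 2.
  apply: acos_le_of_cos_le => //.
    by have := pi_ge0 R => ?; apply/andP; split; lra.
  by rewrite cos_pihalf; case/andP: rho1.
have cA : cos A = C / (p * q) by rewrite acosK// in_itv.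
have th0 : 0 <= th by rewrite -(@atan0 R) le_atan// divr_ge0// ltW.
have thet : th <= et by exact: le_atan.
have etpi2 : et < pi / 2 by exact: atan_ltpi2.
have pi0 := pi_ge0 R.
have sA : 0 <= sin A by rewrite sin_ge0_pi// A0/=; lra.
have sD : 0 <= sin (et - th).
  by rewrite sin_ge0_pi// subr_ge0 thet lerBlDr; lra.
set P := Num.sqrt (p ^+ 2 + a ^+ 2) in cth sth *.
set Q := Num.sqrt (q ^+ 2 + b ^+ 2) in cet set *.
have P0 : 0 < P by rewrite sqrtr_gt0 ltr_wpDr ?sqr_ge0// exprn_gt0.
have Q0 : 0 < Q by rewrite sqrtr_gt0 ltr_wpDr ?sqr_ge0// exprn_gt0.
(* Spherical law of cosines in terms of the elevations [th] and [et]. *)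
have E : (C + a * b) / (P * Q) = cos th * cos et * cos A + sin th * sin et.
  by rewrite cth sth cet set cA; field; rewrite !gt_eqF.
have Cab0 : 0 <= C + a * b by rewrite addr_ge0 ?mulr_ge0// ltW.
(* Cauchy-Schwarz, so that [acos] is taken within its domain. *)
have CS : C + a * b <= P * Q.
  rewrite -ler_sqr ?nnegrE ?(ltW (mulr_gt0 P0 Q0))//.
  rewrite exprMn !sqr_sqrtr ?addr_ge0 ?sqr_ge0//.
  apply: (@le_trans _ _ ((p * q + a * b) ^+ 2)).
    by rewrite ler_sqr ?nnegrE ?lerD2r// addr_ge0 ?(ltW pq0)// mulr_ge0.
  rewrite -subr_ge0; have -> : (p ^+ 2 + a ^+ 2) * (q ^+ 2 + b ^+ 2)
    - (p * q + a * b) ^+ 2 = (p * b - a * q) ^+ 2 by ring.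
  exact: sqr_ge0.
apply: acos_le_of_cos_le.
- apply/andP; split.
    by rewrite (le_trans (lerN10 _))// divr_ge0// ltW// mulr_gt0.
  by rewrite ler_pdivrMr ?mulr_gt0// mul1r.
- by apply/andP; split; [apply: addr_ge0; rewrite ?subr_ge0|lra].
(* In [cos (et - th + A)] the product of sines is dropped, and [cos A <= 1] bounds
   [sin th * sin et * cos A] by [sin th * sin et]. *)
rewrite E cosD cosB.
have cA1 : cos A <= 1 by rewrite cos_le1.
have ss : 0 <= sin th * sin et by rewrite sth set mulr_ge0// divr_ge0// ltW.
nra.
Qed.

(** [kern s (x * y)] is the inner product of the vectors of powers of [x] and of [y], that is, the
    covariance of [f_S(x)] and [f_S(y)]. *)
Definition kern s (z : R) : R := \sum_(e <- s) z ^+ e.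

Lemma kern_gt0 s z : s != [::] -> 0 < z -> 0 < kern s z.
Proof.
case: s => // e s _ z0; rewrite /kern big_cons ltr_wpDr ?exprn_gt0//.
by apply: sumr_ge0 => i _; rewrite exprn_ge0// ltW.
Qed.

(** Cauchy-Schwarz, read off from the factorized Gram matrix: the gap is [al ^+ 2 * ga ^+ 2]. *)
Lemma kern_sqr_le s x y : kern s (x * y) ^+ 2 <= kern s (x * x) * kern s (y * y).
Proof.
have [al [be [ga [alE albeE bega _]]]] := gauss_expect_pair s x y.
rewrite /kern -alE -albeE -bega exprMn ler_wpM2l ?sqr_ge0// lerDl.
exact: sqr_ge0.
Qed.

Definition angle s x y : R :=
  acos (kern s (x * y) / (Num.sqrt (kern s (x * x)) * Num.sqrt (kern s (y * y)))).

(** Squared and cross-multiplied, the inequality holds term by term: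
    [x^(2m) y^(2e) <= y^(2m) x^(2e)] because [e <= m] and [x <= y]. It makes the elevation [theta]
    nondecreasing. *)
Lemma expr_div_kern_le m s x y : s != [::] -> {in s, forall e, (e <= m)%N} ->
  0 < x -> x <= y ->
  x ^+ m / Num.sqrt (kern s (x * x)) <= y ^+ m / Num.sqrt (kern s (y * y)).
Proof.
move=> s0 sm x0 xy; have y0 : 0 < y by exact: lt_le_trans xy.
have Kx : 0 < kern s (x * x) by rewrite kern_gt0// mulr_gt0.
have Ky : 0 < kern s (y * y) by rewrite kern_gt0// mulr_gt0.
rewrite ler_pdivrMr ?sqrtr_gt0// mulrAC ler_pdivlMr ?sqrtr_gt0//.
rewrite -ler_sqr ?nnegrE ?mulr_ge0 ?exprn_ge0 ?sqrtr_ge0 ?(ltW x0) ?(ltW y0)//.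
rewrite !exprMn !sqr_sqrtr ?(ltW Kx) ?(ltW Ky)// /kern !mulr_sumr !big_seq.
apply: ler_sum => e /sm em.
rewrite -(subnK em) [X in X * _]expr2 -exprMn [X in _ <= X * _]expr2 -exprMn.
have xx0 : 0 <= x * x by exact: mulr_ge0 (ltW x0) (ltW x0).
have yy0 : 0 <= y * y by exact: mulr_ge0 (ltW y0) (ltW y0).
rewrite !exprD -!mulrA ler_pM ?(mulr_ge0 (exprn_ge0 _ _)) ?exprn_ge0//.
  by apply: lerXn2r; rewrite ?nnegrE// ler_pM// ltW.
by rewrite mulrC.
Qed.

(** Instance of [acos_suspension_le]: [p] and [q] are the lengths of the vectors over [s] at [x] and
    [y], while [a = x ^+ m] and [b = y ^+ m] are the added coordinates. *)
Lemma angle_cons_le m s x y : s != [::] -> {in s, forall e, (e <= m)%N} ->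
  0 < x -> x <= y ->
  angle (m :: s) x y <=
    (atan (y ^+ m / Num.sqrt (kern s (y * y))) -
     atan (x ^+ m / Num.sqrt (kern s (x * x)))) + angle s x y.
Proof.
move=> s0 sm x0 xy; have y0 : 0 < y by exact: lt_le_trans xy.
have Kx : 0 < kern s (x * x) by rewrite kern_gt0// mulr_gt0.
have Ky : 0 < kern s (y * y) by rewrite kern_gt0// mulr_gt0.
have Kxy : 0 < kern s (x * y) by rewrite kern_gt0// mulr_gt0.
rewrite /angle.
have kE (z : R) : kern (m :: s) z = z ^+ m + kern s z by rewrite /kern big_cons.
have -> : kern (m :: s) (x * y) = kern s (x * y) + x ^+ m * y ^+ m.
  by rewrite kE exprMn addrC.
have -> : kern (m :: s) (x * x) = Num.sqrt (kern s (x * x)) ^+ 2 + (x ^+ m) ^+ 2.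
  by rewrite kE exprMn -expr2 sqr_sqrtr ?(ltW Kx) ?(ltW Ky)// addrC.
have -> : kern (m :: s) (y * y) = Num.sqrt (kern s (y * y)) ^+ 2 + (y ^+ m) ^+ 2.
  by rewrite kE exprMn -expr2 sqr_sqrtr ?(ltW Kx) ?(ltW Ky)// addrC.
apply: acos_suspension_le; rewrite ?sqrtr_gt0//.
- rewrite -ler_sqr ?nnegrE ?(ltW Kxy) ?mulr_ge0 ?sqrtr_ge0//.
  by rewrite exprMn !sqr_sqrtr ?(ltW Kx) ?(ltW Ky)// kern_sqr_le.
- by rewrite exprn_ge0// ltW.
exact: expr_div_kern_le.
Qed.

(** The term [j] is the elevation of the all-ones vector, reached at the point 1, over [j]
    coordinates. *)
Definition angle_bound (k : nat) : R := \sum_(1 <= j < k) atan (Num.sqrt j%:R)^-1.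

(** Induction on [s], sorted so that the head is the largest exponent. The increments of its
    elevation telescope, the initial elevation is nonnegative, and the final one is at most its
    value at 1. *)
Lemma sum_angle_le s (x : nat -> R) n :
  s != [::] -> sorted geq s -> 
  (forall i, 0 < x i) -> {homo x : i j / (i <= j)%N >-> i <= j} -> x n <= 1 ->
  \sum_(0 <= i < n) angle s (x i) (x i.+1) <= angle_bound (size s).
Proof.
move=> + + x0 xle xn1.
elim: s => // m [_ _ _|m' s IH _ /[dup] /path_sorted srt].
  (* With a single exponent all the vectors are positive multiples of one another, so every angle is
     0. *)
  rewrite big1_seq => [|i _]; first by rewrite /angle_bound big_geq.
  rewrite /angle/kern !big_seq1 !exprMn -!expr2 !sqrtr_sqr.
  rewrite !ger0_norm ?exprn_ge0 ?(ltW (x0 _))// divff ?acos1// mulf_neq0//.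
    by rewrite expf_neq0// gt_eqF.
  by rewrite expf_neq0// gt_eqF.
rewrite /= => mle.
have sm : {in m' :: s, forall e, (e <= m)%N}.
  have geq_trans : transitive geq by move=> a b c ba cb; exact: leq_trans cb ba.
  by move=> e /(allP (@order_path_min _ geq m (m' :: s) geq_trans mle)).
pose th i := atan (x i ^+ m / Num.sqrt (kern (m' :: s) (x i * x i))).
have step i : angle (m :: m' :: s) (x i) (x i.+1) <=
    (th i.+1 - th i) + angle (m' :: s) (x i) (x i.+1).
  by apply: angle_cons_le => //; exact: xle.
apply: (le_trans (ler_sum _ (fun i _ => step i))).
rewrite big_split/= telescope_sumr// /angle_bound big_nat_recr//= addrC.
apply: lerD; first exact: IH.
have th0 : 0 <= th 0%N.
  by rewrite -(@atan0 R) le_atan// divr_ge0 ?sqrtr_ge0// exprn_ge0// ltW.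
have thn : th n <= atan (Num.sqrt (size s).+1%:R)^-1.
  have := expr_div_kern_le (isT : m' :: s != [::]) sm (x0 n) xn1.
  rewrite expr1n mulr1 div1r => /le_atan.
  suff -> : kern (m' :: s) 1 = (size s).+1%:R by [].
  rewrite /kern (eq_bigr (fun=> 1)) => [|e _]; last by rewrite expr1n.
  by rewrite big_const_seq count_predT iter_addr_0.
lra.
Qed.

(** * Estimate of the sum of arctangents *)

Lemma atan_le_id (x : R) : 0 <= x -> atan x <= x.
Proof.
rewrite le_eqVlt => /predU1P[<-|x0]; first by rewrite atan0.
have datan z : z \in `]0, x[ -> is_derive z 1 atan (1 + z ^+ 2)^-1.
  by move=> _; exact: is_derive1_atan.
have catan : {within `[0, x], continuous (@atan R)}%classic.
  by apply: derivable_within_continuous => z _; exact: ex_derive.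
have [c _] := MVT x0 datan catan.
rewrite atan0 !subr0 => ->; rewrite ler_piMl ?(ltW x0)// invf_le1.
  by rewrite lerDl sqr_ge0.
by rewrite ltr_wpDr// sqr_ge0.
Qed.

Lemma angle_bound_le k : (2 <= k)%N ->
  angle_bound k <= pi / 4 + 2 * (Num.sqrt (k - 1)%:R - 1).
Proof.
elim: k => // k IH; rewrite ltnS leq_eqVlt => /predU1P[<-|k1].
  by rewrite /angle_bound big_nat1 sqrtr1 invr1 atan1 subrr mulr0 addr0.
rewrite /angle_bound big_nat_recr ?(ltnW k1)//= -/(angle_bound k).
apply: (le_trans (lerD (IH k1) (lexx _))).
have k0 : (0 < k)%N by exact: ltnW.
rewrite -addrA lerD2l subSS subn0.
set a := Num.sqrt k%:R; set b := Num.sqrt (k - 1)%:R.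
have a0 : 0 < a by rewrite sqrtr_gt0 ltr0n.
have b0 : 0 <= b by exact: sqrtr_ge0.
have ab : a ^+ 2 - b ^+ 2 = 1.
  by rewrite !sqr_sqrtr ?ler0n// natrB// opprB addrC subrK.
have : atan a^-1 <= a^-1 by apply: atan_le_id; rewrite invr_ge0 ltW.
(* Multiplied by [a], and with 1 written as [a ^+ 2 - b ^+ 2], this is [0 <= (a - b) ^+ 2]. *)
have : a^-1 <= 2 * (a - b).
  rewrite -[a^-1]mul1r ler_pdivrMr// -[X in X <= _]ab -subr_ge0.
  have -> : 2 * (a - b) * a - (a ^+ 2 - b ^+ 2) = (a - b) ^+ 2 by ring.
  exact: sqr_ge0.
lra.
Qed.

End AngleTelescoping.

(** * Joint measurability and Fatou's lemma *)

Section JointMeasurability.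
Context {R : realType}.
Local Open Scope classical_set_scope.
Local Open Scope ereal_scope.
Implicit Types k : nat.

(* [gauss_expect] integrates over a list one coordinate at a time, so joint
   measurability is propagated by moving the head of the list to the parameter. *)
Fixpoint gmeas k d (T : measurableType d) (G : T -> seq R -> \bar R) : Prop :=
  if k is k'.+1 then gmeas k' (fun (p : T * R) c => G p.1 (p.2 :: c))
  else measurable_fun setT (fun t => G t [::]).

Lemma gauss_expect_ge0 k (F : seq R -> \bar R) :
  (forall c, 0 <= F c) -> 0 <= gauss_expect k F.
Proof.
by elim: k F => [|k IH] F F0 //=; apply: gexp1_ge0 => t; exact: IH.
Qed.

Lemma measurable_gauss_expect k d (T : measurableType d)
    (G : T -> seq R -> \bar R) :
  gmeas k G -> (forall t c, 0 <= G t c) ->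
  measurable_fun setT (fun t => gauss_expect k (G t)).
Proof.
elim: k d T G => [|k IH] d T G //= mG G0.
apply: (@measurable_gexp1 _ _ _
  (fun p : T * R => gauss_expect k (fun c => G p.1 (p.2 :: c)))) => [|p].
  exact: IH.
exact: gauss_expect_ge0.
Qed.

Lemma measurable_gauss_expect_head k d (T : measurableType d)
    (G : T -> seq R -> \bar R) t :
  gmeas k.+1 G -> (forall t c, 0 <= G t c) ->
  measurable_fun setT (fun y : R => gauss_expect k (fun c => G t (y :: c))).
Proof.
move=> mG G0.
have mE := @measurable_gauss_expect k _ _ _ mG (fun p c => G0 p.1 (p.2 :: c)).
exact: (measurableT_comp mE (measurable_pair1 t)).
Qed.

Lemma gmeas_limn_einf k d (T : measurableType d)
    (G : nat -> T -> seq R -> \bar R) :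
  (forall n, gmeas k (G n)) ->
  gmeas k (fun t c => limn_einf (fun n => G n t c)).
Proof.
elim: k d T G => [|k IH] d T G mG.
  apply: (emeasurable_fun_cvg (fun n t => einfs (fun m => G m t [::]) n)).
    by move=> n; exact: measurable_fun_einfs.
  move=> t _; rewrite limn_einf_lim; exact: is_cvg_einfs.
exact: (IH _ _ (fun n p c => G n p.1 (p.2 :: c)) mG).
Qed.

Lemma gmeasD k d (T : measurableType d) (G H : T -> seq R -> \bar R) :
  gmeas k G -> gmeas k H -> gmeas k (fun t c => G t c + H t c).
Proof.
elim: k d T G H => [|k IH] d T G H mG mH; first exact: emeasurable_funD.
exact: (IH _ _ (fun p c => G p.1 (p.2 :: c)) (fun p c => H p.1 (p.2 :: c)) mG mH).
Qed.

Lemma gmeas_cst k d (T : measurableType d) (x : \bar R) :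
  gmeas k (fun (_ : T) _ => x).
Proof. by elim: k d T => [|k IH] d T /=; [exact: measurable_cst|exact: IH]. Qed.

Lemma gmeas_sum k d (T : measurableType d) I (r : seq I)
    (G : I -> T -> seq R -> \bar R) :
  (forall i, gmeas k (G i)) -> gmeas k (fun t c => \sum_(i <- r) G i t c).
Proof.
move=> mG; elim: r => [|i r IH].
  under [X in gmeas _ X]eq_fun do under eq_fun do rewrite big_nil.
  exact: gmeas_cst.
under [X in gmeas _ X]eq_fun do under eq_fun do rewrite big_cons.
exact: gmeasD.
Qed.

(** The offsets [a t] and [b t] collect the terms of the coordinates already moved into the
    parameter, which lets the induction on [s] go through. *)
Lemma gmeas_pair (s : seq nat) (x y : R) (f : R * R -> \bar R)
    d (T : measurableType d) (a b : T -> R) :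
  measurable_fun setT f -> measurable_fun setT a -> measurable_fun setT b ->
  gmeas (size s) (fun t c => f (a t + fS s c x, b t + fS s c y)%R).
Proof.
move=> mf; elim: s d T a b => [|e s IH] d T a b ma mb.
  rewrite /= /fS !big_ord0; apply: (measurableT_comp mf).
  by apply: measurable_fun_pair; exact: measurable_funD.
have h (u : R) (g : T -> R) : measurable_fun setT g ->
    measurable_fun setT (fun p : T * R => g p.1 + u * p.2)%R.
  move=> mg; apply: measurable_funD; first exact: measurableT_comp.
  exact: measurable_funM.
have := IH _ _ _ _ (h (x ^+ e)%R _ ma) (h (y ^+ e)%R _ mb).
under [X in gmeas _ X -> _]eq_fun do under eq_fun do rewrite -!addrA -!fS_cons.
exact.
Qed.

Lemma gauss_expectD k d (T : measurableType d) (G H : T -> seq R -> \bar R) t :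
  gmeas k G -> gmeas k H -> (forall t c, 0 <= G t c) -> (forall t c, 0 <= H t c) ->
  gauss_expect k (fun c => G t c + H t c) =
  gauss_expect k (G t) + gauss_expect k (H t).
Proof.
elim: k d T G H t => [|k IH] d T G H t mG mH G0 H0 //=.
rewrite -[RHS]gexp1D.
- apply: eq_gexp1 => y.
  exact: (IH _ _ (fun p c => G p.1 (p.2 :: c)) (fun p c => H p.1 (p.2 :: c)) (t, y)).
- exact: measurable_gauss_expect_head.
- exact: measurable_gauss_expect_head.
- by move=> y; exact: gauss_expect_ge0.
- by move=> y; exact: gauss_expect_ge0.
Qed.

Lemma gauss_expect_cst k (x : \bar R) : 0 <= x -> gauss_expect k (fun=> x) = x.
Proof.
by move=> x0; elim: k => //= k ->; exact: gexp1_cst.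
Qed.

Lemma gauss_expect_sum k d (T : measurableType d) I (r : seq I)
    (G : I -> T -> seq R -> \bar R) t :
  (forall i, gmeas k (G i)) -> (forall i t c, 0 <= G i t c) ->
  gauss_expect k (fun c => \sum_(i <- r) G i t c) =
  \sum_(i <- r) gauss_expect k (G i t).
Proof.
move=> mG G0; elim: r => [|i r IH].
  rewrite big_nil -[RHS](gauss_expect_cst k)//.
  by congr gauss_expect; apply/funext => c; rewrite big_nil.
rewrite big_cons -IH.
rewrite -(gauss_expectD _ (H := fun t c => \sum_(i <- r) G i t c))//.
- by congr gauss_expect; apply/funext => c; rewrite big_cons.
- exact: gmeas_sum.
- by move=> u c; exact: sume_ge0.
Qed.

(** Fatou is used once per coordinate; monotonicity carries the bound for the inner expectation
    through the outer integral. *)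
Lemma gauss_expect_fatou k d (T : measurableType d)
    (G : nat -> T -> seq R -> \bar R) t :
  (forall n, gmeas k (G n)) -> (forall n t c, 0 <= G n t c) ->
  gauss_expect k (fun c => limn_einf (fun n => G n t c)) <=
  limn_einf (fun n => gauss_expect k (G n t)).
Proof.
elim: k d T G t => [|k IH] d T G t mG G0 //.
apply: le_trans (gexp1_fatou _ _).
- apply: le_gexp1 => y.
    by apply: gauss_expect_ge0 => c; exact: limn_einf_ge0.
  exact: (IH _ _ (fun n p c => G n p.1 (p.2 :: c)) (t, y)).
- by move=> n; exact: measurable_gauss_expect_head.
- by move=> n y; exact: gauss_expect_ge0.
Qed.

(** Only the innermost integral is compared almost everywhere, so the countable exceptional set may
    depend on all earlier coordinates; the outer integrals are compared pointwise. *)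
Lemma le_gauss_expect_last k d (T : measurableType d)
    (F G : T -> seq R -> \bar R) t :
  gmeas k.+1 G -> (forall t c, 0 <= F t c) -> (forall t c, 0 <= G t c) ->
  (forall t c, size c = k ->
    exists2 A : set R, countable A &
      forall a, ~ A a -> F t (rcons c a) <= G t (rcons c a)) ->
  gauss_expect k.+1 (F t) <= gauss_expect k.+1 (G t).
Proof.
elim: k d T F G t => [|k IH] d T F G t mG F0 G0 FG.
  have [A cA FGA] := FG t [::] erefl.
  apply: (@gexp1_le_ae _ _ _ A) => //.
  exact: (measurable_gauss_expect_head t mG).
apply: le_gexp1 => y; first exact: (@gauss_expect_ge0 k.+1 (fun c => F t (y :: c))).
apply: (IH _ _ (fun p c => F p.1 (p.2 :: c)) (fun p c => G p.1 (p.2 :: c)) (t, y)) => //.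
by move=> p c ck; apply: (FG p.1 (p.2 :: c)); rewrite /= ck.
Qed.

End JointMeasurability.

(** * Counting simple zeros by sign changes *)

Section SimpleZeros.
Context {R : realType}.
Local Open Scope classical_set_scope.
Local Open Scope ring_scope.
Implicit Types (p q : {poly R}) (s : seq nat) (c : seq R).

Definition fpoly s c : {poly R} := \sum_(i < size s) c`_i *: 'X^(nth 0%N s i).

Lemma horner_fpoly s c x : (fpoly s c).[x] = fS s c x.
Proof.
by rewrite horner_sum; apply: eq_bigr => i _; rewrite hornerZ hornerXn.
Qed.

Lemma fpoly_rcons s m c a : size c = size s ->
  fpoly (rcons s m) (rcons c a) = fpoly s c + a *: 'X^m.
Proof.
move=> cs; rewrite /fpoly size_rcons big_ord_recr/=; congr (_ + _).
  by apply: eq_bigr => i _; rewrite !nth_rcons cs ltn_ord.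
by rewrite !nth_rcons cs ltnn eqxx.
Qed.

Lemma coef_fpoly_notin s c m : m \notin s -> (fpoly s c)`_m = 0.
Proof.
move=> ms; rewrite coef_sum big1// => i _; rewrite coefZ coefXn.
case: eqP => [mE|]; last by rewrite mulr0.
by move: ms; rewrite mE mem_nth.
Qed.

Lemma finite_roots p : p != 0 -> finite_set [set x | root p x].
Proof.
move=> p0; apply: contrapT => /(@infinite_set_fset _ _ (size p))[B Bp].
rewrite leqNgt => /negP; apply; apply: max_poly_roots => //; last exact: finmap.fset_uniq.
by apply/allP => x xB; exact: Bp.
Qed.

(* A multiple zero x of q + a X^m is a zero of X q' - m q, which does not
   depend on a, and x determines a. *)
Lemma countable_multiple_zero_levels q m : q`_m = 0 ->
  exists2 A : set R, countable A & forall a, ~ A a -> forall x, 0 < x ->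
    (q + a *: 'X^m).[x] = 0 -> (q + a *: 'X^m)^`().[x] != 0.
Proof.
move=> qm; have [->|q0] := eqVneq q 0.
  (* A monomial [a X^m] has no positive zero unless [a = 0]. *)
  exists [set 0] => [|a /eqP a0 x x0]; first exact: countable1.
  rewrite add0r hornerZ hornerXn => /eqP.
  by rewrite mulf_eq0 (negPf a0) expf_eq0 gt_eqF// andbF.
pose W := 'X * q^`() - m%:R *: q.
(* Coefficient [i] of [W] is [(i - m) q_i]; since [q_m = 0], a vanishing [W] would force [q = 0]. *)
have W0 : W != 0.
  apply: contraNneq q0 => W0; apply/eqP/polyP => i; rewrite coef0.
  have [->//|im] := eqVneq i m.
  have : W`_i = (i%:R - m%:R) * q`_i.
    rewrite /W coefB coefXM coefZ coef_deriv.
    case: i im => [|i] im /=; first by rewrite mulr0n sub0r sub0r mulNr.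
    by rewrite mulrBl [X in _ = X - _]mulr_natl.
  rewrite W0 coef0 => /esym/eqP; rewrite mulf_eq0 subr_eq0 eqr_nat (negPf im).
  by move=> /eqP.
(* At each of the finitely many roots [x] of [W], [q(x) + a x^m = 0] is solved for [a]; a root at 0
   may add a default value, which only enlarges the exceptional set. *)
exists [set - (q.[x] / x ^+ m) | x in [set x | root W x]].
  by apply: finite_set_countable; apply: finite_image; exact: finite_roots.
move=> a nA x x0 px; apply/eqP => dpx; apply: nA; exists x; last first.
  move: px; rewrite hornerD hornerZ hornerXn => /eqP; rewrite addr_eq0 => /eqP->.
  by rewrite mulNr opprK mulfK// expf_neq0// gt_eqF.
rewrite /= /root /W hornerD hornerN hornerM hornerX hornerZ.
move: px dpx; rewrite derivD derivZ derivXn !hornerD !hornerZ hornerMn !hornerXn.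
move=> /eqP; rewrite addr_eq0 => /eqP->.
move=> /eqP; rewrite addr_eq0 => /eqP->.
apply/eqP; case: m {qm W W0} => [|m]; first by ring.
by rewrite exprS -[_ *+ _]mulr_natl; ring.
Qed.

(** Factor [p = q (X - x)] with [q(x) != 0]: by continuity [q] keeps its sign near [x], so
    [p(u) p(v)] has the sign of [(u - x) (v - x)]. *)
Lemma simple_zero_sign_change p x : p.[x] = 0 -> p^`().[x] != 0 ->
  exists2 e : R, 0 < e & forall u v, x - e < u -> u <= x -> x <= v -> v < x + e ->
    p.[u] * p.[v] <= 0.
Proof.
move=> /eqP/factor_theorem[q ->]; rewrite derivM derivXsubC mulr1 hornerD hornerM.
rewrite hornerXsubC subrr mulr0 add0r => qx0.
have /cvgrPdist_lt := @continuous_horner R q x.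
move=> /(_ `|q.[x]|); rewrite normr_gt0 => /(_ qx0).
move=> /nbhs_ballP[e /= e0 he]; exists e => // u v xu ux xv vx.
have sgn z : `|x - z| < e -> 0 < q.[x] * q.[z].
  move=> xz; have := he z xz; have [q0|q0|/eqP] := ltgtP 0 q.[x]; last first.
  - by rewrite eq_sym (negPf qx0).
  - by rewrite (ltr0_norm q0) ltr_norml => /andP[? ?]; rewrite nmulr_rgt0//; lra.
  - by rewrite (gtr0_norm q0) ltr_norml => /andP[? ?]; rewrite pmulr_rgt0//; lra.
have qu : 0 < q.[x] * q.[u] by apply: sgn; rewrite ger0_norm ?subr_ge0//; lra.
have qv : 0 < q.[x] * q.[v] by apply: sgn; rewrite ler0_norm ?subr_le0//; lra.
rewrite !hornerM !hornerXsubC.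
have quv : 0 < q.[u] * q.[v].
  rewrite -(pmulr_rgt0 _ (_ : 0 < q.[x] ^+ 2)); last by rewrite exprn_even_gt0.
  have -> : q.[x] ^+ 2 * (q.[u] * q.[v]) = (q.[x] * q.[u]) * (q.[x] * q.[v]) by ring.
  exact: mulr_gt0.
have -> : q.[u] * (u - x) * (q.[v] * (v - x)) = (q.[u] * q.[v]) * ((u - x) * (v - x)).
  by ring.
by rewrite pmulr_rle0// mulr_le0_ge0// ?subr_le0 ?subr_ge0.
Qed.

(** The points [1 / (n + 1), ..., 1]: the shift by one keeps them positive, as the angle bounds
    require, and [grid n n = 1]. *)
Definition grid (n i : nat) : R := i.+1%:R / n.+1%:R.

Lemma gridS n i : grid n i.+1 = grid n i + n.+1%:R^-1.
Proof. by rewrite /grid -(natr1 i.+1) mulrDl mul1r. Qed.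

(** The weak inequality also counts a zero located at a grid point. *)
Definition sign_changes (f : R -> R) (n : nat) : \bar R :=
  (\sum_(0 <= i < n) (f (grid n i) * f (grid n i.+1) <= 0)%R%:R%:E)%E.

(** For [x] at least [1 / (n + 1)], the index of the grid interval, closed on the left, that
    contains [x]; the predecessor compensates the shift in [grid]. *)
Definition cell (n : nat) (x : R) : nat := (Num.truncn (x * n.+1%:R)).-1.

Lemma near_seq (T : eqType) (z : seq T) (P : T -> nat -> Prop) :
  (forall x, x \in z -> \forall n \near \oo, P x n) ->
  \forall n \near \oo, forall x, x \in z -> P x n.
Proof.
elim: z => [|x z IH] h; first by near=> n => x; rewrite in_nil.
have h1 : \forall n \near \oo, P x n by apply: h; rewrite mem_head.
have h2 : \forall n \near \oo, forall y, y \in z -> P y n.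
  by apply: IH => y yz; apply: h; rewrite in_cons yz orbT.
near=> n => y; rewrite in_cons => /predU1P[->|yz].
  by near: n.
by apply: (near h2 n).
Unshelve. all: by end_near. Qed.

Lemma near_invn_lt (e : R) : 0 < e -> \forall n \near \oo, n.+1%:R^-1 < e.
Proof. by move=> e0; exact: (near_infty_natSinv_lt (PosNum e0)). Qed.

Lemma cell_bounds n x : n.+1%:R^-1 <= x -> x < 1 ->
  (cell n x < n)%N /\ grid n (cell n x) <= x < grid n (cell n x).+1.
Proof.
move=> nx x1; have n0 : 0 < n.+1%:R :> R by rewrite ltr0n.
have xn1 : 1 <= x * n.+1%:R by rewrite -ler_pdivrMr// div1r.
have xn0 : 0 <= x * n.+1%:R by exact: le_trans xn1.
have t1 : (1 <= Num.truncn (x * n.+1%:R))%N by rewrite truncn_ge_nat.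
have /andP[tl tu] := truncn_itv xn0.
have tE : (cell n x).+1 = Num.truncn (x * n.+1%:R) by rewrite /cell prednK.
split.
  rewrite -ltnS tE -(@ltr_nat R) (le_lt_trans tl)//.
  by rewrite -[ltRHS]mul1r ltr_pM2r.
by rewrite /grid tE ler_pdivrMr// tl ltr_pdivlMr.
Qed.

Lemma near_le_limn_einf (a : \bar R) (u : (\bar R)^nat) :
  (\forall n \near \oo, a <= u n)%E -> (a <= limn_einf u)%E.
Proof.
move=> [N _ HN]; rewrite limn_einf_lim (cvg_lim _ (@cvg_einfs_sup R u))//.
apply: le_trans (ereal_sup_ubound _); last by exists N.
by apply: le_ereal_inf_tmp => _ [n Nn <-]; exact: HN.
Qed.

(** The number of zeros is a supremum over finite sets [z] of zeros. Once the mesh is below the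
    points of [z], their mutual distances and their sign change radii, these points lie in distinct
    cells, each of which counts as a sign change. *)
Lemma nzeros_in_le_sign_changes p :
  (forall x, 0 < x -> p.[x] = 0 -> p^`().[x] != 0) ->
  (nzeros_in 0 1 (horner p) <= limn_einf (sign_changes (horner p)))%E.
Proof.
move=> simple; apply: ge_ereal_sup => _ [A [finA AS] <-].
have [z zA] : exists z, A = [set` z] /\ uniq z.
  have /finite_seqP[z zA] := finA; exists (undup z); split; last exact: undup_uniq.
  by rewrite zA; apply/seteqP; split => x /=; rewrite mem_undup.
case: zA => AE uz; subst A.
have zS x : x \in z -> [/\ 0 < x, x < 1 & p.[x] = 0].
  by move=> /AS[/andP[? ?] ?].
have N1 : \forall n \near \oo, forall x, x \in z -> n.+1%:R^-1 <= x.
  apply: near_seq => x /zS[x0 _ _].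
  by near do (apply: ltW); exact: near_invn_lt.
have N2 : \forall n \near \oo, forall x, x \in z -> forall y, y \in z ->
    x != y -> n.+1%:R^-1 < `|x - y|.
  apply: near_seq => x xz; apply: near_seq => y yz.
  have [->|xy] := eqVneq x y; first by near=> n.
  have : 0 < `|x - y| by rewrite normr_gt0 subr_eq0.
  by move=> /near_invn_lt; apply: filterS => n.
have N3 : \forall n \near \oo, forall x, x \in z ->
    forall u v, x - n.+1%:R^-1 <= u -> u <= x -> x <= v -> v <= x + n.+1%:R^-1 ->
    p.[u] * p.[v] <= 0.
  apply: near_seq => x /zS[x0 _ px].
  have [e e0 he] := simple_zero_sign_change px (simple x x0 px).
  have := near_invn_lt e0; apply: filterS => n ne u v xu ux xv vx.
  apply: he => //; first by rewrite (lt_le_trans _ xu)// ltrD2l ltrN2.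
  by rewrite (le_lt_trans vx)// ltrD2l.
apply: near_le_limn_einf; near=> n.
have n1 : forall x, x \in z -> n.+1%:R^-1 <= x by exact: (near N1 n).
have n2 : forall x, x \in z -> forall y, y \in z -> x != y ->
  n.+1%:R^-1 < `|x - y| by exact: (near N2 n).
have n3 : forall x, x \in z -> forall u v, x - n.+1%:R^-1 <= u -> u <= x ->
  x <= v -> v <= x + n.+1%:R^-1 -> p.[u] * p.[v] <= 0 by exact: (near N3 n).
have inj : {in z &, injective (cell n)}.
  move=> x y xz yz cxy; apply/eqP; apply: contraT => xy.
  have [x0 x1 _] := zS x xz; have [y0 y1 _] := zS y yz.
  have [_ /andP[xl xu]] := cell_bounds (n1 x xz) x1.
  have [_ /andP[yl yu]] := cell_bounds (n1 y yz) y1.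
  have := n2 x xz y yz xy; move: xl xu yl yu; rewrite cxy gridS ltr_normr.
  move: (grid _ _) (_^-1) => g h ? ? ? ? /orP[]; lra.
pose b i := (p.[grid n i] * p.[grid n i.+1] <= 0).
have sub : {subset [seq cell n x | x <- z] <= [seq i <- iota 0 n | b i]}.
  move=> _ /mapP[x xz ->]; have [x0 x1 _] := zS x xz.
  have [cn /andP[xl xu]] := cell_bounds (n1 x xz) x1.
  rewrite mem_filter mem_iota add0n cn /= andbT.
  apply: (n3 x xz) => //; move: xl xu; rewrite gridS;
    by move: (grid _ _) (_^-1) => g h ? ?; lra.
have sz : (size z <= size [seq i <- iota 0 n | b i])%N.
  rewrite -(size_map (cell n)); apply: uniq_leq_size => //.
  by rewrite map_inj_in_uniq.
have -> : sign_changes (horner p) n = (size [seq i <- iota 0 n | b i])%:R%:E.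
  rewrite /sign_changes sumEFin; congr EFin.
  rewrite size_filter -sum1_count natr_sum [RHS]big_mkcond/= /index_iota subn0.
  by apply: eq_bigr => i _; rewrite /b; case: ifP.
rewrite -fsbig_seq//= sumEFin lee_fin.
by rewrite big_const_seq count_predT iter_addr_0 ler_nat.
Unshelve. all: by end_near. Qed.

End SimpleZeros.

(** * Expected number of zeros *)

Section ExpectedZeros.
Context {R : realType}.
Local Open Scope classical_set_scope.
Local Open Scope ring_scope.
Implicit Types (s : seq nat) (x y : R).

Let measurable_mul_le0 :
  measurable_fun setT (fun p : R * R => (p.1 * p.2 <= 0)%R%:R%:E : \bar R).
Proof.
apply/measurable_EFinP; apply: measurable_le0.
by apply: measurable_funM.
Qed.

Lemma gauss_expect_sign_change_le s x y : s != [::] -> 0 < x -> 0 < y ->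
  (gauss_expect (size s) (fun c => (fS s c x * fS s c y <= 0)%R%:R%:E) <=
   (angle s x y / pi)%:E)%E.
Proof.
move=> s0 x0 y0.
have [al [be [ga [alE albeE bega E]]]] := gauss_expect_pair s x y.
apply: (le_trans (_ : (_ <= gexp1 (fun u => gexp1 (fun v =>
    ((al * u) * (be * u + ga * v) <= 0)%R%:R%:E)))%E)).
  by rewrite (E _ measurable_mul_le0)// => p; rewrite lee_fin.
have albe0 : 0 < al * be by rewrite albeE -/(kern s (x * y)) kern_gt0// mulr_gt0.
apply: (le_trans (gexp2_le0_le ga albe0)).
by rewrite sqrtrM ?sqr_ge0// alE albeE bega.
Qed.

Lemma gmeas_sign_change s x y :
  gmeas (size s) (fun (_ : R) c => (fS s c x * fS s c y <= 0)%R%:R%:E : \bar R).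
Proof.
have := @gmeas_pair R s x y _ _ R (cst 0) (cst 0) measurable_mul_le0
  (measurable_cst _) (measurable_cst _).
by under [X in gmeas _ X -> _]eq_fun do under eq_fun do rewrite /= !add0r.
Qed.

Lemma angle_perm s s' x y : perm_eq s s' -> angle s x y = angle s' x y.
Proof. by move=> ss'; rewrite /angle /kern !(perm_big _ ss'). Qed.

Lemma zS_le_angle_bound s : uniq s -> s != [::] ->
  (zS (R := R) s <= (angle_bound (size s) / pi)%:E)%E.
Proof.
move=> us s0.
(* [F], [S] and [G] are constant in their first argument, which supplies the parameter space that
   [gmeas] asks for; it is set to 0. *)
pose F (_ : R) (c : seq R) := nzeros_in 0 1 (fS s c).
pose S n (_ : R) (c : seq R) := sign_changes (fS s c) n.
pose G t c := limn_einf (fun n => S n t c).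
have S0 n t c : (0 <= S n t c)%E by apply: sume_ge0 => i _; rewrite lee_fin.
have mS n : gmeas (size s) (S n).
  by apply: gmeas_sum => i; exact: gmeas_sign_change.
have le_FG : (gauss_expect (size s) (F 0%R) <= gauss_expect (size s) (G 0%R))%E.
  (* Splitting off the last exponent [m], which is absent from the others, exposes the last
     coefficient as the level [a] in [q + a X^m]. *)
  case/lastP: s s0 us @F @S @G S0 mS => // s m _.
  rewrite rcons_uniq => /andP[ms us] F S G S0 mS; rewrite size_rcons.
  apply: le_gauss_expect_last => [|t c|t c|t c cs].
  - by rewrite -(size_rcons s m); exact: gmeas_limn_einf.
  - by apply: esum_ge0.
  - exact: limn_einf_ge0.
  have [A cA hA] := countable_multiple_zero_levels (coef_fpoly_notin c ms).
  exists A => // a /hA simple; rewrite /F /G /S.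
  have -> : fS (rcons s m) (rcons c a) = horner (fpoly (rcons s m) (rcons c a)).
    by apply/funext => x; rewrite horner_fpoly.
  apply: nzeros_in_le_sign_changes => x x0.
  by rewrite fpoly_rcons//; exact: simple.
apply: (le_trans le_FG).
apply: (@le_trans _ _ (limn_einf (fun n => gauss_expect (size s) (S n 0%R)))).
  exact: (@gauss_expect_fatou R (size s) _ R S 0 mS S0).
have bound n : (gauss_expect (size s) (S n 0%R) <= (angle_bound (size s) / pi)%:E)%E.
  rewrite /S /sign_changes (@gauss_expect_sum R (size s) _ R nat (index_iota 0 n)
    (fun i _ c => (fS s c (grid n i) * fS s c (grid n i.+1) <= 0)%R%:R%:E) 0
    (fun i => gmeas_sign_change s _ _) (fun i t c => _))//.
  have g0 i : 0 < grid n i :> R by rewrite divr_gt0 ?ltr0n.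
  apply: (@le_trans _ _ (\sum_(0 <= i < n) (angle s (grid n i) (grid n i.+1) / pi)%:E)%E).
    by apply: lee_sum => i _; exact: gauss_expect_sign_change_le.
  rewrite sumEFin lee_fin -mulr_suml ler_pM2r ?invr_gt0 ?pi_gt0//.
  (* Sorting into decreasing order leaves every [angle] unchanged, as [kern] is a sum over the
     exponents. *)
  rewrite -(size_sort geq).
  under eq_bigr do rewrite -(angle_perm _ _ (permEl (perm_sort geq s))).
  apply: sum_angle_le => //.
- by rewrite -size_eq0 size_sort size_eq0.
- by apply: sort_sorted => a b; exact: leq_total.
- by move=> i j ij; rewrite ler_pM2r ?invr_gt0 ?ltr0n// ler_nat.
- by rewrite /grid divff.
(* The lower limit is a supremum of tail infima, each at most its first term. *)
rewrite limn_einf_lim (cvg_lim _ (@cvg_einfs_sup R _))//.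
apply: ge_ereal_sup => _ [n _ <-]; apply: (le_trans (ereal_inf_lbound _) (bound n)).
by exists n => /=.
Qed.

End ExpectedZeros.

Theorem theorem1p1 (R : realType) (s : seq nat) (k : nat) :
  uniq s -> size s = k -> (1 <= k)%N ->
  (zS (R := R) s <= (2 / pi * Num.sqrt ((k - 1)%:R))%:E)%E /\
  ((2 <= k)%N ->
     (zS (R := R) s <= (4^-1 + 2 / pi * (Num.sqrt ((k - 1)%:R) - 1))%:E)%E /\
     4^-1 + 2 / pi * (Num.sqrt ((k - 1)%:R) - 1) <= 2 / pi * Num.sqrt ((k - 1)%:R) :> R).
Proof.
move=> us sk k1; have pi0 := pi_gt0 R.
have s0 : s != [::] by rewrite -size_eq0 sk -lt0n.
have zle := @zS_le_angle_bound R s us s0; rewrite sk in zle.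
have quarter_le : 4^-1 + 2 / pi * (Num.sqrt (k - 1)%:R - 1) <=
    2 / pi * Num.sqrt (k - 1)%:R :> R.
  (* The two sides differ by [2 / pi - 1 / 4], which is nonnegative since [pi < 4]. *)
  rewrite mulrBr mulr1 addrCA gerDl subr_le0 ler_pdivlMr//.
  by have := pihalf_lt2 R; lra.
have zle2 : (2 <= k)%N ->
    (zS (R := R) s <= (4^-1 + 2 / pi * (Num.sqrt ((k - 1)%:R) - 1))%:E)%E.
  move=> k2; apply: (le_trans zle); rewrite lee_fin ler_pdivrMr//.
  have distr (p b : R) : 0 < p -> (4^-1 + 2 / p * b) * p = p / 4 + 2 * b.
    by move=> p0; field; rewrite gt_eqF.
  by rewrite distr//; exact: angle_bound_le.
split=> [|k2]; last by split=> //; exact: zle2.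
move: k1; rewrite leq_eqVlt => /predU1P[k1|k2].
  (* For [k = 1] the bound is 0, as [angle_bound 1] is an empty sum. *)
  move: zle; rewrite -k1 /angle_bound big_geq// mul0r subnn sqrtr0 mulr0.
  exact.
by apply: (le_trans (zle2 k2)); rewrite lee_fin.
Qed.
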